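(* Let $G=(V,E)$ be a connected loopless multigraph and let $U$ be a (non-empty) clique of $G$. Let $M=E_G(U)$ and $N\subseteq E(G-U)$. If each component of $G[M]$ is a star with a center in $V-U$, then $$\tau_G(M\cup N)=|U|^{|U|-2-|M|}\sum_{T\in\mathcal{ST}_{G\bullet U}(N)}|U|^{|E_T(u)|},$$ where $u$ is the vertex of $G\bullet U$ created by contracting all edges of $G[U]$.
   Context: Graphs are finite multigraphs without loops (parallel edges allowed). A set $U$ of vertices is a clique of $G$ if $G[U]$ is a complete graph; in particular $G[U]$ has no parallel edges. $E_G(U)$ is the set of edges of $G$ with one end in $U$ and the other in $V-U$. $G-U$ is the subgraph induced by $V-U$, so $E(G-U)$ is the set of edges with both ends in $V-U$. For a set of edges $M$, $G[M]$ is the subgraph consisting of the edges in $M$ and their end-vertices. The condition on $M$ is equivalent to: each vertex in $U$ is incident with at most one edge of $M$. $\mathcal{ST}_G(W)$ is the set of spanning trees $T$ of $G$ with $W\subseteq E(T)$, and $\tau_G(W)=|\mathcal{ST}_G(W)|$ (spanning trees are distinguished by their edge sets). $G\bullet U$ is obtained from $G$ by contracting all edges of $G[U]$; its vertex set is $(V-U)\cup\{u\}$, its edge set is identified with $E-E(G[U])$, and parallel edges are kept. $E_T(u)$ is the set of edges of $T$ incident with $u$. *)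

(* Defs.v *)
From HB Require Import structures.
From mathcomp Require Import all_boot all_order all_algebra.

Set Implicit Arguments.
Unset Strict Implicit.
Unset Printing Implicit Defensive.

(* Finite multigraphs without loops: distinct edges may have the same set of
   ends (parallel edges), and having two distinct ends excludes loops. *)
Record mgraph := MGraph {
  vertex : finType;
  edge : finType;
  ends : edge -> {set vertex};
  card_ends : forall e, #|ends e| = 2 }.

Section Subgraphs.

Variable G : mgraph.

Implicit Types (S U : {set vertex G}) (A W : {set edge G}).

(* Subgraphs are given as pairs (S, A) of a vertex set S and an edge set A
   whose ends lie in S. *)

Definition adj A : rel (vertex G) :=
  fun x y => [exists e in A, ends e == [set x; y]].

Definition connected_sub S A : bool :=
  (S != set0) && [forall x in S, forall y in S, connect (adj A) x y].

Definition connected : bool := connected_sub setT setT.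

(* E_A(x) *)
Definition incident A (x : vertex G) : {set edge G} :=
  [set e in A | x \in ends e].

(* V(G[A]); the edge set of G[A] is A. *)
Definition vsupport A : {set vertex G} := \bigcup_(e in A) ends e.

(* Edge sets of cycles: nonempty connected 2-regular subgraphs.  A pair of
   parallel edges is a cycle. *)
Definition is_cycle A : bool :=
  connected_sub (vsupport A) A
  && [forall x in vsupport A, #|incident A x| == 2].

Definition acyclic A : bool :=
  [forall C : {set edge G}, (C \subset A) ==> ~~ is_cycle C].

(* A spanning tree is identified with its edge set. *)
Definition spanning_tree A : bool := connected_sub setT A && acyclic A.

Definition ST W : {set {set edge G}} :=
  [set T : {set edge G} | spanning_tree T & W \subset T].

Definition tau W : nat := #|ST W|.

(* E(G[S]) *)
Definition induced_edges S : {set edge G} := [set e | ends e \subset S].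

(* E_G(U): exactly one of the two ends lies in U. *)
Definition boundary U : {set edge G} := [set e | #|ends e :&: U| == 1].

Definition clique U : Prop :=
  forall x y, x \in U -> y \in U -> x != y ->
    #|[set e | ends e == [set x; y]]| = 1.

(* Vertex sets of the connected components of (S, A). *)
Definition components S A : {set {set vertex G}} :=
  equivalence_partition (connect (adj A)) S.

(* (S, A) is a simple star with center c; both ends of a one-edge star are
   centers. *)
Definition star_at (c : vertex G) S A : Prop :=
  [/\ c \in S,
      forall e, e \in A -> c \in ends e /\ ends e \subset S
    & forall x, x \in S -> x != c ->
        #|[set e in A | ends e == [set c; x]]| = 1].

End Subgraphs.

Section Contraction.

Variables (G : mgraph) (U : {set vertex G}).

(* None is the new vertex u. *)
Definition contract_vertex : finType := option {x : vertex G | x \notin U}.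

Definition contract_edge : finType :=
  {e : edge G | e \notin induced_edges U}.

Definition contract_proj : vertex G -> contract_vertex := insub.

Definition contract_ends (e : contract_edge) : {set contract_vertex} :=
  contract_proj @: ends (val e).

Lemma card_contract_ends e : #|contract_ends e| = 2.
Proof.
rewrite /contract_ends card_in_imset ?card_ends //.
have := valP e; rewrite inE; set f := val e => /subsetPn[z fz zU].
have /eqP/cards2P[a [b [_ Ef]]] := card_ends f.
have key x y : x \notin U -> contract_proj x = contract_proj y -> x = y.
  move=> xU; rewrite /contract_proj insubT.
  by case: insubP => // v _ <- [<-].
move=> x y fx fy Exy.
have [xU|/key] := boolP (x \in U); last exact.
have [yU|/key/(_ (esym Exy))] := boolP (y \in U); last by [].
move: fz fx fy; rewrite Ef !inE.
by do 3![case/orP=> /eqP ?]; subst => //; rewrite ?xU ?yU in zU.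
Qed.

(* Contracting all edges of G[U].  When U is a nonempty clique, G[U] is
   connected, so that this merges U into a single vertex. *)
Definition contract : mgraph := MGraph card_contract_ends.

Definition contracted_vertex : vertex contract := None.

(* The edges of the contraction lying in A, under the identification of
   E(contract) with E(G) - E(G[U]). *)
Definition contract_set (A : {set edge G}) : {set edge contract} :=
  [set e : contract_edge | val e \in A].

End Contraction.

(* Main.v *)
Require Import Defs.
From HB Require Import structures.
From mathcomp Require Import all_boot all_order all_algebra.
From mathcomp Require Import ring.

Set Implicit Arguments.
Unset Strict Implicit.
Unset Printing Implicit Defensive.

Import Order.TTheory GRing.Theory Num.Theory.
Local Open Scope ring_scope.

(** Let k be the size of the clique U.  A spanning tree of G, or of the graph
    obtained by contracting U to u, meets the edges avoiding U in a set F, and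
    the identity holds for each F separately; only forests F matter.

    On the left, the trees with a given F that contain M are the completions of
    the forest formed by M and F by edges of the clique.  The number of ways to
    complete a forest with components C_1, ..., C_r by edges of a clique U is
    k^(r-2) times the product of the #|C_i :&: U|; this generalizes Cayley's
    formula ([card_clique_completions]).  On the right, the trees with a given F
    are the completions of F by edges at u, and there are as many as there are
    ways to choose an edge from u to every component of F not containing u
    ([card_star_completions]); each of them has as many edges at u as there are
    such components.

    Both counts come from one principle ([card_completions_unique]).  Counting
    pairs of a completion and one of its new edges gives
    (r - 1) c(A) = sum of c(e |: A) over the usable edges e that join two
    components of A, and this recursion has only one solution that takes the
    value 1 on trees.

    Finally the two products agree ([clique_weight_contract]).  By the star
    hypothesis every vertex of U is on at most one edge of M, so adding M to F
    hangs distinct vertices of U as leaves on the components of F, and leaves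
    k - #|M| vertices of U isolated.  The trace on U of an enlarged component is
    thus as large as its number of edges to u, and r - 2 equals k - 2 - #|M|
    plus the number of components of F outside U. *)

(** * Reachability through an edge set *)

Section EdgeSets.

Variable G : mgraph.
Implicit Types (A B S T : {set edge G}) (X : {set vertex G}) (e f : edge G).
Implicit Types (x y z : vertex G).

Definition reach A : rel (vertex G) := connect (adj A).

Lemma endsP e x : x \in ends e -> exists2 y, x != y & ends e = [set x; y].
Proof.
have /eqP/cards2P[a [b [nab ->]]] := card_ends e.
rewrite !inE => /orP[]/eqP->; first by exists b.
by exists a; [rewrite eq_sym | rewrite setUC].
Qed.

Lemma ends_neq e x y : ends e = [set x; y] -> x != y.
Proof. by move=> E; have := card_ends e; rewrite E cards2; case: eqP. Qed.

Lemma reach_refl A x : reach A x x.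
Proof. exact: connect0. Qed.

Lemma reach_sym A : symmetric (reach A).
Proof.
apply: sym_connect_sym => x y; rewrite /adj.
by under eq_existsb => e do rewrite setUC.
Qed.

Lemma reach_trans A : transitive (reach A).
Proof. exact: connect_trans. Qed.

Lemma reach_edge A e x y :
  e \in A -> x \in ends e -> y \in ends e -> reach A x y.
Proof.
move=> eA /endsP[z _ E]; rewrite E !inE => /orP[]/eqP->; first exact: connect0.
by apply/connect1/existsP; exists e; rewrite eA E eqxx.
Qed.

(** The induction principle for reachability: almost every fact that two
    vertices are not linked is obtained by exhibiting an edge-closed set. *)
Lemma reach_closed A X x y :
    (forall e a b, e \in A -> a \in ends e -> b \in ends e ->
       a \in X -> b \in X) ->
  x \in X -> reach A x y -> y \in X.
Proof.
move=> XA xX /connectP[p pP ->]; elim: p x xX pP => //= a p IH x xX.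
case/andP=> /existsP[e /andP[eA /eqP E]]; apply: IH.
by apply: (XA e x) => //; rewrite E !inE eqxx ?orbT.
Qed.

Lemma reach_mono A B x y : A \subset B -> reach A x y -> reach B x y.
Proof.
move=> /subsetP AB xy; suff: y \in [set z | reach B x z] by rewrite inE.
apply: reach_closed xy; last by rewrite inE reach_refl.
move=> e a b /AB eB ae be; rewrite !inE => /reach_trans; apply.
exact: reach_edge eB ae be.
Qed.

Lemma reach_isolated A x y :
  (forall e, e \in A -> x \notin ends e) -> reach A x y -> y = x.
Proof.
move=> iso xy; apply/set1P; apply: reach_closed xy; last exact: set11.
by move=> e a b eA ae _; rewrite inE => /eqP ax; have := iso e eA; rewrite -ax ae.
Qed.

Lemma reach_add A e x y a b : ends e = [set x; y] ->
  reach (e |: A) a b =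
    [|| reach A a b, reach A a x && reach A y b | reach A a y && reach A x b].
Proof.
move=> E; apply/idP/idP => [ab|].
  (* The vertices reachable from a by using e at most once. *)
  pose X := [set c | [|| reach A a c, reach A a x && reach A y c
                      | reach A a y && reach A x c]].
  suff: b \in X by rewrite inE.
  apply: reach_closed ab; last by rewrite inE reach_refl.
  move=> f c d; rewrite in_setU1 => /orP[/eqP->|fA].
    rewrite E !inE => /orP[]/eqP-> /orP[]/eqP->; rewrite ?reach_refl ?andbT //.
      by case/or3P => [->|/andP[-> _]|->]; rewrite ?orbT.
    by case/or3P => [->|->|/andP[-> _]]; rewrite ?orbT.
  move=> cf df; have cd := reach_edge fA cf df; rewrite !inE.
  case/or3P => [ac|/andP[-> ac]|/andP[-> ac]]; rewrite (reach_trans ac cd) ?orbT //.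
have sA : A \subset e |: A by apply: subsetUr.
have exy : reach (e |: A) x y.
  by apply: (@reach_edge _ e); rewrite ?E ?inE ?eqxx ?orbT.
have eyx : reach (e |: A) y x by rewrite reach_sym.
case/or3P => [|/andP[p q]|/andP[p q]]; first exact: reach_mono.
  by apply: reach_trans (reach_mono sA p) (reach_trans exy (reach_mono sA q)).
by apply: reach_trans (reach_mono sA p) (reach_trans eyx (reach_mono sA q)).
Qed.

(** An edge e that joins A has its ends in different components of A; for e
    in A, [joins (A :\ e) e] says that e is a bridge of A. *)
Definition joins A e : bool :=
  [exists x in ends e, exists y in ends e, ~~ reach A x y].

Lemma joinsE A e x y : ends e = [set x; y] -> joins A e = ~~ reach A x y.
Proof.
move=> E; apply/exists_inP/idP => [[a + /exists_inP[b]]|nxy].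
  rewrite E !inE => /orP[]/eqP-> /orP[]/eqP-> //; rewrite ?reach_refl //.
  by rewrite reach_sym.
exists x; first by rewrite E !inE eqxx.
by apply/exists_inP; exists y => //; rewrite E !inE eqxx orbT.
Qed.

Lemma joins_sub A B e : A \subset B -> joins B e -> joins A e.
Proof.
move=> AB; have /eqP/cards2P[x [y [_ E]]] := card_ends e.
by rewrite !(joinsE _ E); apply: contra; apply: reach_mono.
Qed.

Lemma joins_notin A e : joins A e -> e \notin A.
Proof.
have /eqP/cards2P[x [y [_ E]]] := card_ends e.
rewrite (joinsE _ E); apply: contra => eA.
by apply: (reach_edge eA); rewrite E !inE eqxx ?orbT.
Qed.

(** * Acyclic edge sets are those all of whose edges are bridges *)

Definition deg A x := #|incident A x|.

Lemma degU1 A e x : e \notin A -> deg (e |: A) x = ((x \in ends e) + deg A x)%N.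
Proof.
move=> eA; rewrite /deg /incident; case: (boolP (x \in ends e)) => xe.
  have -> : [set f in e |: A | x \in ends f] = e |: [set f in A | x \in ends f].
    by apply/setP => f; rewrite !inE; case: eqP => // ->.
  by rewrite cardsU1 inE (negbTE eA).
by apply: eq_card => f; rewrite !inE; case: eqP => // ->; rewrite (negbTE xe) !andbF.
Qed.

Lemma deg_gt0P A x : reflect (exists2 e, e \in A & x \in ends e) (0 < deg A x)%N.
Proof.
apply: (iffP card_gt0P) => [[e]|[e eA xe]]; last by exists e; rewrite inE eA.
by rewrite inE => /andP[]; exists e.
Qed.

Lemma deg_vsupport A x : (x \in vsupport A) = (0 < deg A x)%N.
Proof. by apply/bigcupP/deg_gt0P => -[e eA xe]; exists e. Qed.

(** The degree formula counts z once for the edge entering it along the path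
    and once for the edge leaving it.  In this form it survives induction on
    the path without a case distinction on the ends, and it yields degree 2
    everywhere once the path is closed up by one more edge. *)
Lemma path_edges A x p : uniq (x :: p) -> path (adj A) x p ->
  exists P : {set edge G}, [/\ P \subset A,
    forall z, deg P z = ((z \in p) + (z \in belast x p))%N
    & forall z, z \in x :: p -> reach P x z].
Proof.
elim: p x => [|y p IH] x /=.
  move=> _ _; exists set0; split; first exact: sub0set.
    by move=> z; apply/eqP; rewrite cards_eq0; apply/eqP/setP => e; rewrite !inE.
  by move=> z; rewrite inE => /eqP->; apply: reach_refl.
case/andP; rewrite inE negb_or => /andP[nxy xp] Uyp.
case/andP => /existsP[e /andP[eA /eqP E]] pP.
have [P [PA dP rP]] := IH y Uyp pP.
have xbel : x \notin belast y p.
  apply: contra xp => /(mem_belast); rewrite inE (negbTE nxy) //.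
have eP : e \notin P.
  apply/negP => eP; have: (0 < deg P x)%N.
    by apply/deg_gt0P; exists e => //; rewrite E !inE eqxx.
  by rewrite dP (negbTE xp) (negbTE xbel).
have exy : reach (e |: P) x y.
  by apply: (@reach_edge _ e); rewrite ?E ?inE ?eqxx ?orbT.
exists (e |: P); split.
- by rewrite subUset sub1set eA.
- move=> z; rewrite (degU1 _ eP) dP E !inE.
  have [->|zx] := eqVneq z x.
    by rewrite (negbTE nxy) (negbTE xp) (negbTE xbel).
  have [->|zy] := eqVneq z y; last by [].
  by case/andP: Uyp => /negbTE->.
- move=> z; rewrite inE => /orP[/eqP->|/rP yz]; first exact: reach_refl.
  by apply: reach_trans exy (reach_mono (subsetUr _ _) yz).
Qed.

Lemma sum_deg A X :
  (\sum_(x in X) deg A x = \sum_(e in A) #|ends e :&: X|)%N.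
Proof.
transitivity (\sum_(x in X) \sum_(e in A | x \in ends e) 1)%N.
  by apply: eq_bigr => x _; rewrite sum1dep_card.
rewrite (exchange_big_dep (mem A)) /=; last by move=> x e _ /andP[].
apply: eq_bigr => e eA; rewrite -sum1_card; apply: eq_bigl => x.
by rewrite !inE eA andbC.
Qed.

(** Otherwise, in the component of one end x of e in A without e, every vertex
    has degree 2 except x, which has degree 1, so that the degrees have an odd
    sum. *)
Lemma cycle_not_bridge A e : is_cycle A -> e \in A -> ~~ joins (A :\ e) e.
Proof.
case/andP=> _ /forall_inP reg eA.
have /eqP/cards2P[x [y [nxy E]]] := card_ends e.
rewrite (joinsE _ E) negbK; apply/contraT => nr.
pose B := A :\ e; pose X := [set z | reach B x z].
have xX : x \in X by rewrite inE reach_refl.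
have eB : e \notin B by rewrite !inE eqxx.
have AE : A = e |: B by rewrite setD1K.
have degB z : z \in X -> deg B z = (if z == x then 1 else 2)%N.
  move=> zX; have /eqP : deg A z == 2%N.
    apply: reg; rewrite deg_vsupport AE degU1 // E !inE addn_gt0.
    have [//|zx] := eqVneq z x; rewrite orbC.
    case: (posnP (deg B z)) => [dz|//].
    move: zX; rewrite inE reach_sym => /reach_isolated zx'.
    rewrite zx' ?eqxx // in zx.
    move=> f fB; apply/negP => zf; have: (0 < deg B z)%N.
      by apply/deg_gt0P; exists f.
    by rewrite dz.
  have zy : (z == y) = false.
    by apply/eqP => zy; move: zX; rewrite zy inE (negbTE nr).
  rewrite AE degU1 // E !inE zy orbF; case: eqP => _; last by [].
  by case.
have : ~~ odd (\sum_(z in X) deg B z)%N.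
  rewrite sum_deg; elim/big_ind: _ => // [a b|f fB]; first by rewrite oddD => /negbTE-> /negbTE->.
  have [->|[z]] := set_0Vmem (ends f :&: X); first by rewrite cards0.
  rewrite !inE => /andP[zf zX]; suff -> : ends f :&: X = ends f by rewrite card_ends.
  apply/setIidPl/subsetP => t tf; rewrite inE.
  by apply: reach_trans zX (reach_edge fB zf tf).
rewrite (bigD1 x) //= degB // eqxx.
rewrite (eq_bigr (fun=> 2%N)); last first.
  by move=> z /andP[zX zx]; rewrite degB // (negbTE zx).
by rewrite sum_nat_const oddD oddM andbF.
Qed.

(** A cycle has no bridge; conversely, an edge whose ends remain linked after
    its removal closes up a simple path into a cycle. *)
Lemma acyclicP A :
  reflect (forall e, e \in A -> joins (A :\ e) e) (acyclic A).
Proof.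
apply: (iffP forall_inP) => [acy e eA|br C CA]; last first.
  apply/negP => cyc; have [e eC] : exists e, e \in C.
    case/andP: (cyc) => /andP[/set0Pn[x]]; rewrite deg_vsupport.
    by case/deg_gt0P => e eC _; exists e.
  have /negP := cycle_not_bridge cyc eC; apply.
  by apply: joins_sub (br e (subsetP CA e eC)); apply: setSD.
have /eqP/cards2P[x [y [nxy E]]] := card_ends e.
rewrite (joinsE _ E); apply/negP => /connectP[p0 p0P yE].
case/shortenP: p0P yE => p pP Up _ {p0} yE.
have [P [PA dP rP]] := path_edges Up pP.
have eP : e \notin P by apply/negP => /(subsetP PA); rewrite !inE eqxx.
have CA : e |: P \subset A.
  by rewrite subUset sub1set eA; apply: subset_trans PA (subsetDl _ _).
have dC z : deg (e |: P) z = (2 * (z \in x :: p))%N.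
  rewrite degU1 // dP E !inE yE.
  have := mem_rcons (belast x p) (last x p) z; rewrite -lastI => Hl.
  rewrite inE in Hl.
  have Ul : last x p \notin belast x p.
    by move: Up; rewrite lastI rcons_uniq => /andP[].
  move: Hl; rewrite inE.
  have [-> _|zx] := eqVneq z x.
    case/andP: (Up) => /negbTE -> _ /=.
    have -> : x \in belast x p; last by [].
    by case: (p) yE nxy => [/= ->|*]; rewrite ?eqxx //= mem_head.
  have [->|zl] := eqVneq z (last x p); first by rewrite (negbTE Ul) /= => ->.
  by move=> /= ->; case: (z \in _).
have /negP := acy _ CA; apply; apply/andP; split.
  rewrite /connected_sub; apply/andP; split.
    by apply/set0Pn; exists x; rewrite deg_vsupport dC mem_head.
  have rC z : z \in vsupport (e |: P) -> reach (e |: P) x z.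
    rewrite deg_vsupport dC; case: (boolP (z \in x :: p)) => // zp _.
    by apply: reach_mono (rP z zp); apply: subsetUr.
  apply/forall_inP => a /rC xa; apply/forall_inP => b /rC xb.
  by move: xa; rewrite reach_sym => xa; apply: reach_trans xa xb.
apply/forall_inP => z; rewrite deg_vsupport -/(deg _ z) dC.
by case: (z \in x :: p).
Qed.

Lemma acyclic_sub A B : A \subset B -> acyclic B -> acyclic A.
Proof.
move=> AB /forall_inP acy; apply/forall_inP => C CA.
by apply: acy; apply: subset_trans CA AB.
Qed.

(** If adding e turned the bridge f = ab of A into a non-bridge, then a and b
    would be linked through e outside f, hence the ends of e through f in A. *)
Lemma acyclic_add A e : acyclic A -> joins A e -> acyclic (e |: A).
Proof.
move=> /acyclicP br je; have eA := joins_notin je.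
apply/acyclicP => f; rewrite in_setU1 => /orP[/eqP->|fA]; first by rewrite setU1K.
have ef : e != f by apply: contraNneq eA => ->.
have -> : (e |: A) :\ f = e |: A :\ f.
  by apply/setP => g; rewrite !inE; case: (eqVneq g e) => [->|]; rewrite ?ef.
have /eqP/cards2P[x [y [nxy E]]] := card_ends e.
have /eqP/cards2P[a [b [nab F]]] := card_ends f.
move: je (br f fA); rewrite !(joinsE _ F) (joinsE _ E) => nxy' nab'.
rewrite (reach_add _ _ _ E) (negbTE nab') /=; apply: contra nxy'.
have sA : A :\ f \subset A by apply: subD1set.
have ab : reach A a b by apply: (@reach_edge _ f); rewrite ?F ?inE ?eqxx ?orbT.
case/orP => /andP[/(reach_mono sA) p /(reach_mono sA) q].
  rewrite reach_sym; apply: reach_trans q _; rewrite reach_sym.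
  by apply: reach_trans _ ab; rewrite reach_sym.
apply: reach_trans q _; rewrite reach_sym.
by apply: reach_trans _ ab; rewrite reach_sym.
Qed.

(** * Components *)

Definition comp_of A x : {set vertex G} := [set y | reach A x y].
Definition comps A : {set {set vertex G}} := components [set: vertex G] A.

Lemma mem_comp_of A x y : (y \in comp_of A x) = reach A x y.
Proof. by rewrite inE. Qed.

Lemma compsP A (C : {set vertex G}) :
  reflect (exists x, C = comp_of A x) (C \in comps A).
Proof.
have E x : [set y in [set: vertex G] | connect (adj A) x y] = comp_of A x.
  by apply/setP => y; rewrite !inE.
apply: (iffP imsetP) => [[x _ ->]|[x ->]]; first by exists x; rewrite E.
by exists x; rewrite ?inE ?E.
Qed.

Lemma comp_of_comps A x : comp_of A x \in comps A.
Proof. by apply/compsP; exists x. Qed.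

Lemma comp_of_eq A x y : (comp_of A x == comp_of A y) = reach A x y.
Proof.
apply/eqP/idP => [E|xy]; first by rewrite -mem_comp_of E mem_comp_of reach_refl.
apply/setP => z; rewrite !mem_comp_of; apply/idP/idP; last exact: reach_trans.
by apply: reach_trans; rewrite reach_sym.
Qed.

Lemma reach_congr A x y z : reach A x y -> reach A x z = reach A y z.
Proof. by rewrite -comp_of_eq -!mem_comp_of => /eqP->. Qed.

Lemma comps_eq A C x : C \in comps A -> x \in C -> C = comp_of A x.
Proof. by case/compsP => y ->; rewrite mem_comp_of -comp_of_eq => /eqP. Qed.

Lemma comps_neq0 A C : C \in comps A -> exists x, x \in C.
Proof. by case/compsP => x ->; exists x; rewrite mem_comp_of reach_refl. Qed.

(** The components other than those of x and y survive unchanged because e has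
    no end in them. *)
Lemma comps_add A e x y : joins A e -> ends e = [set x; y] ->
  comps (e |: A) =
    (comp_of A x :|: comp_of A y) |: (comps A :\ comp_of A x :\ comp_of A y).
Proof.
move=> je E; have := je; rewrite (joinsE _ E) => nxy.
have comp_ofU z : comp_of (e |: A) z =
    if (z \in comp_of A x) || (z \in comp_of A y) then comp_of A x :|: comp_of A y else comp_of A z.
  apply/setP => t; rewrite (fun_if (fun S : {set _} => t \in S)) in_setU !mem_comp_of.
  rewrite (reach_add _ _ _ E) (reach_sym A x z) (reach_sym A y z).
  have [zx|nzx] := boolP (reach A z x).
    have -> : reach A z t = reach A x t by apply: reach_congr.
    have [zy|_] /= := boolP (reach A z y); last by rewrite orbF.
    by case/negP: nxy; apply: reach_trans zy; rewrite reach_sym.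
  have [zy|//] := boolP (reach A z y).
    have -> : reach A z t = reach A y t by apply: reach_congr.
    by rewrite /= orbC.
  by rewrite /= orbF.
apply/setP => C; rewrite !inE; apply/compsP/idP => [[z ->]|].
  rewrite comp_ofU !mem_comp_of; case: ifP => [_|]; first by rewrite eqxx.
  move/negbT; rewrite negb_or => /andP[xz yz].
  by rewrite !comp_of_eq comp_of_comps !(reach_sym _ z) yz xz !orbT.
case/orP => [/eqP->|/and3P[Cy Cx /compsP[z Cz]]].
  by exists x; rewrite comp_ofU mem_comp_of reach_refl.
by exists z; rewrite comp_ofU !mem_comp_of -!comp_of_eq -Cz !(eq_sym _ C) (negbTE Cx) (negbTE Cy).
Qed.

Section MergeBig.

Variables (R : Type) (idx : R) (op : Monoid.com_law idx).
Variables (w : {set vertex G} -> R) (A : {set edge G}) (e : edge G).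
Variables (x y : vertex G).
Hypotheses (je : joins A e) (E : ends e = [set x; y]).

(** This lemma and the next isolate, in a product over the components before
    and after adding e, the common factor of the components e does not touch. *)
Lemma big_comps_split :
  \big[op/idx]_(C in comps A) w C =
    op (w (comp_of A x)) (op (w (comp_of A y))
      (\big[op/idx]_(C in comps A :\ comp_of A x :\ comp_of A y) w C)).
Proof.
have := je; rewrite (joinsE _ E) => nxy.
rewrite (big_setD1 _ (comp_of_comps A x)) /= (big_setD1 (comp_of A y)) //=.
by rewrite !inE comp_of_comps comp_of_eq reach_sym nxy.
Qed.

Lemma big_comps_add :
  \big[op/idx]_(C in comps (e |: A)) w C =
    op (w (comp_of A x :|: comp_of A y))
      (\big[op/idx]_(C in comps A :\ comp_of A x :\ comp_of A y) w C).
Proof.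
have := je; rewrite (joinsE _ E) => nxy.
rewrite (comps_add je E) big_setU1 //=.
rewrite !inE !negb_and; apply/orP; right; apply/orP; right.
apply/negP => cU; have := comps_eq (x := y) cU; rewrite inE !mem_comp_of reach_refl orbT.
move=> /(_ isT) /setP/(_ x); rewrite inE !mem_comp_of reach_refl reach_sym.
by rewrite (negbTE nxy).
Qed.

End MergeBig.

Lemma card_comps_add A e : joins A e -> #|comps A| = #|comps (e |: A)|.+1.
Proof.
move=> je; have /eqP/cards2P[x [y [_ E]]] := card_ends e.
rewrite -!sum1_card (big_comps_split _ _ je E) (big_comps_add _ _ je E) /=.
by [].
Qed.

Lemma card_acyclic A : acyclic A -> (#|A| + #|comps A|)%N = #|vertex G|.
Proof.
move Dn : #|A| => n; elim: n A Dn => [|n IH] A Dn acyA.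
  have A0 : A = set0 by apply/eqP; rewrite -cards_eq0 Dn.
  have -> : comps A = [set [set x] | x in [set: vertex G]].
    apply: eq_in_imset => x _; apply/setP => y; rewrite !inE.
    apply/idP/eqP => [xy|->]; last exact: connect0.
    by apply: reach_isolated xy => e; rewrite A0 inE.
  by rewrite card_imset ?cardsT //; apply: set1_inj.
have /card_gt0P[e eA] : (0 < #|A|)%N by rewrite Dn.
have je := elimT (acyclicP A) acyA e eA.
have := cardsD1 e A; rewrite eA Dn add1n => -[/esym nA].
have := IH _ nA (acyclic_sub (subD1set A e) acyA).
by rewrite (card_comps_add je) setD1K // addnS.
Qed.

Lemma spanning_treeE A : spanning_tree A = (#|comps A| == 1)%N && acyclic A.
Proof.
congr andb; apply/andP/cards1P => [[/set0Pn[x _] /forall_inP cA]|[C CE]].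
  exists (comp_of A x); apply/setP => C; rewrite inE; apply/compsP/eqP => [[y ->]|->].
    by apply/eqP; rewrite comp_of_eq; move/forall_inP: (cA y (in_setT _)) => /(_ x (in_setT _)).
  by exists x.
split.
  have : C \in comps A by rewrite CE set11.
  by case/compsP => x _; apply/set0Pn; exists x; rewrite inE.
apply/forall_inP => x _; apply/forall_inP => y _.
rewrite -/(reach A x y) -comp_of_eq.
have := comp_of_comps A x; have := comp_of_comps A y; rewrite CE !inE.
by move=> /eqP-> /eqP->.
Qed.

Lemma comps_gt0 A (u : vertex G) : (0 < #|comps A|)%N.
Proof. by apply/card_gt0P; exists (comp_of A u); apply: comp_of_comps. Qed.

(** * Counting the completions of a forest *)

Definition completions S A : {set {set edge G}} :=
  [set T | [&& spanning_tree T, A \subset T & T \subset A :|: S]].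

Lemma completions_acyclic S A T : T \in completions S A -> acyclic A.
Proof. by rewrite inE => /and3P[/andP[_ acy] AT _]; apply: acyclic_sub AT acy. Qed.

Lemma card_completion S A T :
  T \in completions S A -> #|T :\: A| = #|comps A|.-1.
Proof.
move=> TA; have /card_acyclic nA := completions_acyclic TA.
move: TA; rewrite inE spanning_treeE => /and3P[/andP[/eqP T1 /card_acyclic nT] AT _].
rewrite cardsD (setIidPr AT) -[#|T|](addnK 1%N) -T1 nT -nA T1.
by rewrite subnAC addKn subn1.
Qed.

(** Count the pairs of a completion T and an edge e of T outside A in two ways:
    the number of such e in T depends only on the number of components of A, and
    the trees T that use e are the completions of A with e added. *)
Lemma completions_rec S A : acyclic A ->
  (#|comps A|.-1 * #|completions S A|
    = \sum_(e in S | joins A e) #|completions S (e |: A)|)%N.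
Proof.
move=> acyA.
transitivity (\sum_(T in completions S A) #|T :\: A|)%N.
  by rewrite mulnC -sum_nat_const; apply: eq_bigr => T /card_completion.
transitivity (\sum_(T in completions S A) \sum_(e in T :\: A) 1)%N.
  by apply: eq_bigr => T _; rewrite sum1_card.
rewrite (exchange_big_dep (fun e => (e \in S) && joins A e)) /=; last first.
  move=> T e; rewrite inE => /and3P[/andP[_ acyT] AT TAS] /setDP[eT eA].
  have := subsetP TAS e eT; rewrite inE (negbTE eA) => /= ->.
  apply: joins_sub (elimT (acyclicP T) acyT e eT).
  by apply/subsetP => f fA; rewrite !inE (subsetP AT) // andbT; apply: contraNneq eA => <-.
apply: eq_bigr => e /andP[eS je]; rewrite sum1dep_card.
apply: eq_card => T; rewrite !inE (joins_notin je) /= subUset sub1set -setUA.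
rewrite [e |: (A :|: S)](setUidPr _); last by rewrite sub1set inE eS orbT.
by rewrite -!andbA; do !bool_congr.
Qed.

(** The recursion above ends at spanning trees, so it determines the number of
    completions: a proposed formula only has to be tested against it.  The
    vertex u excludes the empty graph, whose empty forest has no component. *)
Lemma card_completions_unique S (u : vertex G) (phi : {set edge G} -> rat) :
    (forall A, acyclic A -> #|comps A| = 1%N -> phi A = 1) ->
    (forall A, acyclic A ->
       #|comps A|.-1%:R * phi A = \sum_(e in S | joins A e) phi (e |: A)) ->
  forall A, acyclic A -> #|completions S A|%:R = phi A.
Proof.
move=> base step A; move Dn : #|comps A| => n.
elim: n A Dn => [|[|n] IH] A Dn acyA.
- by have := comps_gt0 A u; rewrite Dn.
- rewrite base //; apply/eqP; rewrite pnatr_eq1; apply/cards1P; exists A.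
  apply/setP => T; rewrite !inE; apply/idP/eqP => [TA|->]; last first.
    by rewrite spanning_treeE Dn acyA eqxx subxx subsetUl.
  have : T \in completions S A by rewrite inE.
  move/card_completion/eqP; rewrite Dn cards_eq0 setD_eq0 => TA'.
  by apply/eqP; rewrite eqEsubset TA'; case/and3P: TA.
have n0 : n.+1%:R != 0 :> rat by rewrite pnatr_eq0.
apply: (mulfI n0); have := step A acyA; rewrite Dn /= => ->.
rewrite -natrM; have := completions_rec S acyA; rewrite Dn => /= ->.
rewrite natr_sum; apply: eq_bigr => e /andP[_ je]; apply: IH.
  by have := card_comps_add je; rewrite Dn => -[].
exact: acyclic_add.
Qed.

End EdgeSets.

(** * Completions by the edges of a clique or by the edges at a vertex *)

Section CompletionCounts.

Variable G : mgraph.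
Implicit Types (A S : {set edge G}) (U C D : {set vertex G}) (u x y z : vertex G).

Lemma comps1 A u : #|comps A| = 1%N -> comps A = [set setT].
Proof.
move/eqP/cards1P => [C CE]; rewrite CE; congr [set _]; apply/setP => x.
have := comp_of_comps A x; rewrite CE !inE => /eqP <-.
by rewrite mem_comp_of reach_refl.
Qed.

(** An edge of the clique at z is determined by its other end, and it is joining
    when this end lies outside the component of z. *)
Lemma card_clique_star U A z : clique U -> z \in U ->
  #|[set e in induced_edges U | joins A e && (z \in ends e)]|
    = #|U :\: comp_of A z|.
Proof.
move=> clU zU; rewrite -[RHS]sum1_card.
transitivity (\sum_(y in U :\: comp_of A z) \sum_(e | ends e == [set z; y]) 1)%N.
  rewrite (exchange_big_dep
    (mem [set e in induced_edges U | joins A e && (z \in ends e)])) /=; last first.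
    move=> y e; rewrite in_setD mem_comp_of => /andP[nzy yU] /eqP E.
    rewrite !inE (joinsE _ E) nzy E !inE eqxx /= andbT.
    by apply/subsetP => t; rewrite !inE => /orP[]/eqP->.
  rewrite -sum1_card; apply: eq_bigr => e; rewrite !inE => /and3P[eU je ze].
  have [y nzy E] := endsP ze; rewrite (joinsE _ E) in je.
  rewrite (big_pred1 y) // => t /=; rewrite in_setD mem_comp_of E.
  apply/andP/eqP => [[/andP[_ tU] /eqP zyt]|->].
    have := set22 z y; rewrite zyt !inE eq_sym (negbTE nzy) /=.
    by move/eqP.
  by rewrite je eqxx (subsetP eU) // E set22.
apply: eq_bigr => y; rewrite in_setD mem_comp_of => /andP[nzy yU].
rewrite sum1dep_card clU //; by apply: contraNneq nzy => ->; apply: reach_refl.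
Qed.

(** Each component C contributes #|C :&: U| terms equal to its inverse. *)
Lemma sum_inv_comps U A :
    (forall C, C \in comps A -> C :&: U != set0) ->
  \sum_(z in U) (#|comp_of A z :&: U|%:R : rat)^-1 = #|comps A|%:R.
Proof.
move=> meet.
rewrite (partition_big (comp_of A) (mem (comps A))) /=; last by move=> z _; apply: comp_of_comps.
rewrite -sum1_card natr_sum; apply: eq_bigr => C CA.
rewrite (eq_bigr (fun=> (#|C :&: U|%:R)^-1)); last by move=> z /andP[_ /eqP->].
rewrite sumr_const (eq_card (B := C :&: U)).
  by rewrite -[LHS]mulr_natr mulVf // pnatr_eq0 cards_eq0 meet.
move=> z; rewrite !inE [RHS]andbC; apply/andP/andP => -[zU].
  by move=> /eqP <-; rewrite mem_comp_of reach_refl.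
by move=> zC; split=> //; apply/eqP; rewrite -(comps_eq CA zC).
Qed.

(** With k the size of U and r components C, this is the product of the sizes
    of the C :&: U times k^(r-2); giving each component its own factor k makes
    the merging of components easy to follow. *)
Definition clique_weight U A : rat :=
  (\prod_(C in comps A) (#|U| * #|C :&: U|)%:R) / #|U|%:R ^+ 2.

(** If b(z) is the number of vertices of U in the component of z, adding an
    edge xy of the clique multiplies the weight by
    (b(x) + b(y)) / (k b(x) b(y)) = (1/b(x) + 1/b(y)) / k.  Summed over the
    edges at each z in U, where k - b(z) of them are joining, this factor gives
    the sum of (k - b(z)) / (k b(z)) over U, which is r - 1.  If some component
    misses U, both sides vanish, because no edge of the clique touches it. *)
Lemma clique_weight_step U A u : clique U -> u \in U ->
  #|comps A|.-1%:R * clique_weight U A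
    = \sum_(e in induced_edges U | joins A e) clique_weight U (e |: A).
Proof.
move=> clU uU; set k : rat := #|U|%:R.
have k0 : k != 0 by rewrite pnatr_eq0 -lt0n; apply/card_gt0P; exists u.
have [/forall_inP meet|/forall_inPn[C CA /negPn/eqP C0]] :=
  boolP [forall C in comps A, C :&: U != set0]; last first.
  have w0 B : C \in comps B -> clique_weight U B = 0.
    by move=> CB; rewrite /clique_weight (big_setD1 C) //= C0 cards0 muln0 !mul0r.
  rewrite w0 // mulr0 big1 // => e /andP[]; rewrite inE => eU je.
  have /eqP/cards2P[x [y [_ E]]] := card_ends e.
  have notC t : t \in ends e -> C != comp_of A t.
    move=> te; apply: contra_eqN C0 => /eqP->; apply/set0Pn; exists t.
    by rewrite in_setI mem_comp_of reach_refl (subsetP eU).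
  by apply: w0; rewrite (comps_add je E) !inE CA !notC ?orbT // E !inE eqxx ?orbT.
pose b z : rat := #|comp_of A z :&: U|%:R.
have b0 z : b z != 0 by rewrite pnatr_eq0 cards_eq0 meet ?comp_of_comps.
have edge_step e : joins A e ->
    clique_weight U (e |: A) = clique_weight U A / k * \sum_(z in ends e) (b z)^-1.
  move=> je; have /eqP/cards2P[x [y [nxy E]]] := card_ends e.
  rewrite /clique_weight (big_comps_add _ _ je E) (big_comps_split _ _ je E) /=.
  set P := \prod_(_ in _) _; rewrite E big_setU1 ?inE //= big_set1.
  have disj : comp_of A x :&: U :&: (comp_of A y :&: U) = set0.
    apply/setP => t; rewrite !inE; apply/negP.
    case/andP => /andP[xt _] /andP[yt _]; move: je; rewrite (joinsE _ E) => /negP[].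
    by apply: reach_trans xt _; rewrite reach_sym.
  rewrite setIUl cardsU disj cards0 subn0.
  have := b0 x; have := b0 y.
  rewrite !natrM natrD -/(b x) -/(b y) -/k.
  move: (b x) (b y) => p q q0 p0; field.
  by rewrite k0 p0 q0.
rewrite (eq_bigr _ (fun e je => edge_step e (proj2 (andP je)))) -mulr_sumr.
(* Exchange the sums: first the vertex z of U, then the joining edges at z. *)
suff -> : \sum_(e in induced_edges U | joins A e) \sum_(z in ends e) (b z)^-1
    = k * #|comps A|.-1%:R by field.
rewrite (exchange_big_dep (mem U)) /=; last first.
  by move=> e z /andP[+ _]; rewrite inE => /subsetP; apply.
transitivity (\sum_(z in U) (k * (b z)^-1 - 1)).
  apply: eq_bigr => z zU; rewrite sumr_const.
  rewrite (eq_card (B := [set e in induced_edges U | joins A e && (z \in ends e)])).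
    rewrite (card_clique_star _ clU zU) cardsD setIC -mulr_natr.
    by rewrite natrB ?subset_leq_card ?subsetIr // mulrBr mulVf // mulrC.
  by move=> e; rewrite unfold_in !inE -andbA.
rewrite big_split /= sumrN -mulr_sumr sum_inv_comps // sumr_const.
by rewrite -{1}(prednK (comps_gt0 A u)) -natr1 mulrDr mulr1 addrK.
Qed.

(** For the empty forest and U the set of all vertices this is Cayley's formula. *)
Lemma card_clique_completions U A u : clique U -> u \in U -> acyclic A ->
  #|completions (induced_edges U) A|%:R = clique_weight U A.
Proof.
move=> clU uU; move: A.
apply: (card_completions_unique u) => [A _ /(comps1 u) A1|A _];
  last exact: clique_weight_step clU uU.
rewrite /clique_weight A1 big_set1 setTI natrM expr2 divff //.
by apply: mulf_neq0; rewrite pnatr_eq0 -lt0n; apply/card_gt0P; exists u.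
Qed.

Lemma others_comps u A :
  [set D in comps A | u \notin D] = comps A :\ comp_of A u.
Proof.
apply/setP => D; rewrite !inE andbC.
case: (boolP (D \in comps A)) => [DA|_]; last by rewrite !andbF.
rewrite !andbT; have [uD|uD] := boolP (u \in D); first by rewrite (comps_eq DA uD) eqxx.
by apply/esym/eqP => DE; move: uD; rewrite DE mem_comp_of reach_refl.
Qed.

Lemma card_others u A : #|[set D in comps A | u \notin D]| = #|comps A|.-1.
Proof. by rewrite others_comps (cardsD1 (comp_of A u) (comps A)) comp_of_comps. Qed.

Definition links u C := [set e in incident setT u | ends e :&: C != set0].

(** A completion by edges at u picks, for each component that does not contain
    u, one edge between u and that component. *)
Definition star_weight u A : rat :=
  \prod_(C in comps A) (if u \in C then 1 else #|links u C|%:R).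

(** Adding an edge from u into a component D removes the factor of D, and there
    are as many such edges as this factor says: every D not containing u
    contributes one copy of the weight. *)
Lemma star_weight_step u A :
  #|comps A|.-1%:R * star_weight u A
    = \sum_(e in incident setT u | joins A e) star_weight u (e |: A).
Proof.
pose w C : rat := if u \in C then 1 else #|links u C|%:R.
pose others := comps A :\ comp_of A u.
have othersE D : (D \in others) = (D \in comps A) && (u \notin D).
  by rewrite /others -others_comps inE.
transitivity (\sum_(D in others) \sum_(e in links u D) \prod_(C in comps A :\ D) w C).
  rewrite -(card_others u) others_comps -/others.
  rewrite -mulr_natl mulr1 mulr_natl -sumr_const; apply: eq_bigr => D.
  rewrite othersE => /andP[DA uD].
  by rewrite sumr_const /star_weight (big_setD1 D) //= (negbTE uD) mulr_natl.
rewrite (exchange_big_dep [pred e | (e \in incident setT u) && joins A e]) /=; last first.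
  move=> D e; rewrite othersE => /andP[DA uD].
  rewrite inE => /andP[eu /set0Pn[t]]; rewrite inE eu => /andP[te tD] /=.
  move: eu; rewrite !inE => /= /endsP[y _ E]; rewrite (joinsE _ E) reach_sym.
  move: te; rewrite E !inE => /orP[]/eqP tE; rewrite tE in tD; first by rewrite tD in uD.
  by rewrite (comps_eq DA tD) mem_comp_of in uD.
apply: eq_bigr => e /andP[eu je].
have uend : u \in ends e by move: eu; rewrite !inE.
have [y nuy E] := endsP uend; have := je; rewrite (joinsE _ E) => nr.
rewrite (big_pred1 (comp_of A y)) => [|D]; last first.
  rewrite othersE [e \in links _ _]inE eu /= -andbA; apply/and3P/eqP => [[DA uD /set0Pn[t]]|->].
    rewrite inE E !inE => /andP[/orP[]/eqP-> tD]; first by rewrite tD in uD.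
    exact: comps_eq DA tD.
  rewrite comp_of_comps mem_comp_of reach_sym nr; split=> //; apply/set0Pn; exists y.
  by rewrite in_setI mem_comp_of reach_refl E set22.
rewrite [RHS](big_comps_add _ _ je E) in_setU mem_comp_of reach_refl /= mul1r.
rewrite (big_setD1 (comp_of A u)) /=; last first.
  by rewrite in_setD1 comp_of_comps comp_of_eq nr.
rewrite {1}/w mem_comp_of reach_refl mul1r; apply: eq_bigl => C.
by rewrite !inE andbCA.
Qed.

Lemma card_star_completions u A : acyclic A ->
  #|completions (incident setT u) A|%:R = star_weight u A.
Proof.
move: A; apply: (card_completions_unique u) => [A _ /(comps1 u) A1|A _];
  last exact: star_weight_step.
by rewrite /star_weight A1 big_set1 inE.
Qed.

End CompletionCounts.

(** * Comparing the graph with its contraction *)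

Section Contracting.

Variables (G : mgraph) (U : {set vertex G}).
Implicit Types (A F : {set edge G}) (C : {set vertex G}) (e : edge G).
Implicit Types (x y z t : vertex G).

Local Notation outer := (induced_edges (~: U)).
Local Notation proj := (contract_proj U).
Local Notation u := (contracted_vertex U).

Lemma card_endsI e x y :
  ends e = [set x; y] -> #|ends e :&: U| = ((x \in U) + (y \in U))%N.
Proof.
move=> E; rewrite E -sum1_card.
rewrite (eq_bigl (fun z => (z \in [set x; y]) && (z \in U))); last first.
  by move=> z; rewrite in_setI.
rewrite big_mkcondr big_setU1 ?inE ?(ends_neq E) //= big_set1.
by case: (x \in U); case: (y \in U).
Qed.

Lemma boundaryE e :
  (e \in boundary U) = (e \notin induced_edges U) && (e \notin outer).
Proof.
have /eqP/cards2P[x [y [_ E]]] := card_ends e.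
rewrite !inE (card_endsI E) E !subUset !sub1set !inE.
by case: (x \in U); case: (y \in U).
Qed.

Lemma inner_notin_outer e : e \in induced_edges U -> e \notin outer.
Proof.
have /eqP/cards2P[x [y [_ E]]] := card_ends e.
by rewrite !inE E !subUset !sub1set !inE => /andP[-> _].
Qed.

Lemma boundaryP e : e \in boundary U ->
  exists x y, [/\ x \in U, y \notin U & ends e = [set x; y]].
Proof.
have /eqP/cards2P[x [y [_ E]]] := card_ends e.
rewrite inE (card_endsI E); case: (boolP (x \in U)) => xU; case: (boolP (y \in U)) => yU //.
  by exists x, y.
by exists y, x; rewrite setUC.
Qed.

Lemma outer_end e x : e \in outer -> x \in ends e -> x \notin U.
Proof. by rewrite inE => /subsetP eU /eU; rewrite inE. Qed.

Lemma proj_eq_None x : (proj x == u) = (x \in U).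
Proof.
rewrite /contract_proj; case: insubP => [v xU _|]; first by rewrite (negbTE xU).
by rewrite negbK => ->.
Qed.

Lemma proj_inj x y : x \notin U -> proj x = proj y -> x = y.
Proof.
rewrite /contract_proj => xU; rewrite insubT.
by case: insubP => // v _ <- [<-].
Qed.

Lemma proj_surj v : v != u -> exists2 x, x \notin U & v = proj x.
Proof.
case: v => // v _; exists (val v); first exact: (valP v).
by rewrite /contract_proj valK.
Qed.

Lemma mem_contract_ends (e : edge (contract U)) :
  (u \in ends e) = (val e \in boundary U).
Proof.
rewrite boundaryE (valP e) /=; apply/imsetP/idP => [[x xe /eqP]|].
  rewrite eq_sym proj_eq_None => xU; apply/negP => /outer_end/(_ xe).
  by rewrite xU.
rewrite inE => /subsetPn[x xe]; rewrite inE negbK => xU; exists x => //.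
by apply/esym/eqP; rewrite proj_eq_None.
Qed.

Lemma proj_ends (e : edge (contract U)) x :
  x \in ends (val e) -> proj x \in ends e.
Proof. exact: imset_f. Qed.

Lemma lift_edge e : e \notin induced_edges U -> exists e' : edge (contract U), val e' = e.
Proof. by move=> eU; exists (Sub e eU); rewrite SubK. Qed.

(** Edges that avoid U are untouched by the contraction. *)
Lemma reach_proj F x y : F \subset outer -> x \notin U -> y \notin U ->
  reach (contract_set U F) (proj x) (proj y) = reach F x y.
Proof.
move=> /subsetP FU xU yU; apply/idP/idP => xy.
  have: proj y \in proj @: (comp_of F x :\: U).
    apply: reach_closed xy; last first.
      by apply/imsetP; exists x => //; rewrite in_setD xU mem_comp_of reach_refl.
    move=> e a b; rewrite inE => eF /imsetP[a' a'e ->] /imsetP[b' b'e ->].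
    case/imsetP => c; rewrite in_setD mem_comp_of => /andP[cU xc] ac.
    have Ec := proj_inj cU (esym ac); rewrite {}Ec in xc cU.
    apply/imsetP; exists b' => //; rewrite in_setD mem_comp_of.
    rewrite (outer_end (FU _ eF) b'e) /=.
    exact: reach_trans xc (reach_edge eF a'e b'e).
  case/imsetP => c; rewrite in_setD mem_comp_of => /andP[cU xc] yc.
  by rewrite (proj_inj yU yc).
suff: y \in [set t | reach (contract_set U F) (proj x) (proj t)] by rewrite inE.
apply: reach_closed xy; last by rewrite inE reach_refl.
move=> e a b eF ae be; rewrite !inE => xa; apply: reach_trans xa _.
have [e' ee] : exists e' : edge (contract U), val e' = e.
  by apply: lift_edge; apply/negP => /inner_notin_outer; rewrite FU.
by apply: (@reach_edge _ _ e'); rewrite ?inE ?ee //; apply: proj_ends; rewrite ee.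
Qed.

Lemma contract_isolated F (e : edge (contract U)) :
  F \subset outer -> e \in contract_set U F -> u \notin ends e.
Proof.
move=> /subsetP FU; rewrite inE => /FU eO.
by rewrite mem_contract_ends boundaryE eO andbF.
Qed.

Lemma not_reach_contracted F z : F \subset outer -> z \notin U ->
  reach (contract_set U F) (proj z) u = false.
Proof.
move=> FU zU; apply/negP; rewrite reach_sym => /reach_isolated.
move/(_ (fun f => contract_isolated FU))/eqP.
by rewrite proj_eq_None (negbTE zU).
Qed.

Lemma acyclic_contract F : F \subset outer -> acyclic (contract_set U F) = acyclic F.
Proof.
move=> FU; have bridge (e : edge (contract U)) : val e \in F ->
    joins (contract_set U F :\ e) e = joins (F :\ val e) (val e).
  move=> eF; have /eqP/cards2P[x [y [_ E]]] := card_ends (val e).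
  have eO := subsetP FU _ eF.
  have xU : x \notin U by apply: outer_end eO _; rewrite E set21.
  have yU : y \notin U by apply: outer_end eO _; rewrite E set22.
  have Ec : ends e = [set proj x; proj y].
    by rewrite /ends /= /contract_ends E imsetU1 imset_set1.
  rewrite (joinsE _ E) (joinsE _ Ec) -reach_proj //; last first.
    exact: subset_trans (subD1set _ _) FU.
  by congr (~~ reach _ _ _); apply/setP => f; rewrite !inE.
apply/acyclicP/acyclicP => br e eF.
  have [e' ee] : exists e' : edge (contract U), val e' = e.
    by apply: lift_edge; apply/negP => /inner_notin_outer; rewrite (subsetP FU).
  by rewrite -ee -bridge ?ee //; apply: br; rewrite inE ee.
by move: eF; rewrite inE => eF; rewrite bridge //; apply: br.
Qed.

(** Let M be the boundary of U, F a set of edges avoiding U, and A their union.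
    Under the following hypothesis every vertex of U is isolated or a leaf in
    A, so that passing from F to A only hangs leaves on components of F. *)

Section Stars.

Hypothesis matched : forall x e f, x \in U -> e \in boundary U ->
  f \in boundary U -> x \in ends e -> x \in ends f -> e = f.

Lemma deg_boundary_le1 x : x \in U -> (deg (boundary U) x <= 1)%N.
Proof.
move=> xU; apply/card_le1_eqP => e f; rewrite inE => /andP[eM xe].
by rewrite inE => /andP[fM xf]; apply: (matched xU).
Qed.

Section Forest.

Variable F : {set edge G}.
Hypothesis FU : F \subset outer.

Local Notation A := (boundary U :|: F).

Lemma inner_end_boundary x e : x \in U -> e \in A -> x \in ends e -> e \in boundary U.
Proof.
move=> xU; rewrite in_setU => /orP[//|/(subsetP FU) eO xe].
by have := outer_end eO xe; rewrite xU.
Qed.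

(** The edges of M can be added one at a time: the end in U of a new edge is
    still isolated. *)
Lemma acyclic_boundary : acyclic F -> acyclic A.
Proof.
move=> acyF.
have ext n (B : {set edge G}) : #|B| = n -> B \subset boundary U -> acyclic (B :|: F).
  elim: n B => [|n IH] B nB BM.
    by move/eqP: nB; rewrite cards_eq0 => /eqP->; rewrite set0U.
  have /card_gt0P[e eB] : (0 < #|B|)%N by rewrite nB.
  have := cardsD1 e B; rewrite eB nB add1n => -[/esym nBe].
  have := IH _ nBe (subset_trans (subD1set _ _) BM).
  rewrite -{2}(setD1K eB) -setUA => /acyclic_add; apply.
  have eM := subsetP BM e eB; have [x [y [xU yU E]]] := boundaryP eM.
  have xe : x \in ends e by rewrite E set21.
  rewrite (joinsE _ E); apply: contraNN yU => /reach_isolated -> // f fB.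
  apply/negP => xf; have fA : f \in A.
    by move: fB; rewrite !in_setU => /orP[/setD1P[_ /(subsetP BM)->]|->]; rewrite ?orbT.
  have ef := matched xU eM (inner_end_boundary xU fA xf) xe xf.
  move: fB; rewrite -ef in_setU !inE eqxx /= => /(subsetP FU) eO.
  by have := outer_end eO xe; rewrite xU.
exact: ext erefl (subxx _).
Qed.

(** The vertices linked to x in A form the component of x in F together with
    the M-neighbours of that component in U. *)
Lemma reach_outer x y : x \notin U -> y \notin U -> reach A x y = reach F x y.
Proof.
move=> xU yU; apply/idP/idP => [xy|]; last by apply: reach_mono; apply: subsetUr.
pose X := comp_of F x :|: \bigcup_(e in boundary U | ends e :&: comp_of F x :\: U != set0) ends e.
have memX t : t \in X -> t \notin U -> reach F x t.
  rewrite in_setU mem_comp_of => /orP[//|/bigcupP[e /andP[eM /set0Pn[c cX]]] te tU].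
  move: cX; rewrite in_setD in_setI mem_comp_of => /and3P[cU ce xc].
  move: te ce; have [a [b [aU bU ->]]] := boundaryP eM.
  rewrite !inE => /orP[]/eqP Et; first by rewrite Et aU in tU.
  by case/orP=> /eqP Ec; [rewrite Ec aU in cU | rewrite Et -Ec].
suff yX : y \in X by apply: memX.
apply: reach_closed xy; last by rewrite in_setU mem_comp_of reach_refl.
move=> e a b eA ae be aX.
have [aU|aU] := boolP (a \in U).
  have eM := inner_end_boundary aU eA ae.
  move: aX; rewrite in_setU mem_comp_of => /orP[xa|/bigcupP[f /andP[fM fX] af]].
    move: xa; rewrite reach_sym => /reach_isolated xa; rewrite xa ?aU // in xU.
    move=> f fF; apply/negP => af; have := outer_end (subsetP FU f fF) af.
    by rewrite aU.
  rewrite in_setU; apply/orP; right; apply/bigcupP; exists e => //.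
  by rewrite eM (matched aU eM fM ae af).
have xa := memX a aX aU; rewrite in_setU.
move: (eA); rewrite in_setU => /orP[eM|eF]; last first.
  by rewrite mem_comp_of (reach_trans xa (reach_edge eF ae be)).
apply/orP; right; apply/bigcupP; exists e => //; rewrite eM /=.
by apply/set0Pn; exists a; rewrite in_setD in_setI aU ae mem_comp_of.
Qed.

Lemma comps_closed C e a b : C \in comps A -> e \in A ->
  a \in ends e -> b \in ends e -> a \in C -> b \in C.
Proof.
by move=> CA eA ae be aC; rewrite (comps_eq CA aC) mem_comp_of (reach_edge eA ae be).
Qed.

(** An edge of M at a vertex of U puts its other end, which lies outside U, into
    the component of that vertex. *)
Lemma inner_compsE :
  [set C in comps A | C \subset U]
    = set1 @: [set x in U | deg (boundary U) x == 0%N].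
Proof.
apply/setP => C; rewrite inE; apply/andP/imsetP => [[CA CU]|[x]].
  have [x xC] := comps_neq0 CA; have xU := subsetP CU x xC.
  have d0 : deg (boundary U) x == 0%N.
    rewrite -leqn0 leqNgt; apply/deg_gt0P => -[e eM xe].
    have [a [b [_ bU E]]] := boundaryP eM; case/negP: bU; apply: (subsetP CU).
    by apply: (comps_closed CA _ xe _ xC); rewrite ?in_setU ?eM // E set22.
  exists x; first by rewrite inE xU.
  rewrite (comps_eq CA xC); apply/setP => y; rewrite mem_comp_of inE.
  apply/idP/eqP => [|->]; last exact: reach_refl.
  apply: reach_isolated => e eA; apply/negP => xe.
  have : (0 < deg (boundary U) x)%N.
    by apply/deg_gt0P; exists e => //; apply: inner_end_boundary xe.
  by rewrite (eqP d0).
rewrite inE => /andP[xU /eqP d0] ->; rewrite sub1set; split=> //.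
apply/compsP; exists x; apply/setP => y; rewrite mem_comp_of inE.
apply/eqP/idP => [->|]; first exact: reach_refl.
apply: reach_isolated => e eA; apply/negP => xe.
have : (0 < deg (boundary U) x)%N.
  by apply/deg_gt0P; exists e => //; apply: inner_end_boundary xe.
by rewrite d0.
Qed.

(** The remaining components of A contain exactly one component of F outside U,
    which this map extracts; its image lives in the contraction. *)
Definition comp_image C : {set vertex (contract U)} := proj @: (C :\: U).

Lemma mem_comp_image C x : x \notin U -> (proj x \in comp_image C) = (x \in C).
Proof.
move=> xU; apply/imsetP/idP => [[y + xy]|xC]; last by exists x; rewrite // in_setD xU.
by rewrite in_setD -(proj_inj xU xy) => /andP[].
Qed.

Lemma comp_image_of z : z \notin U ->
  comp_image (comp_of A z) = comp_of (contract_set U F) (proj z).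
Proof.
move=> zU; apply/setP => v; rewrite mem_comp_of; have [->|/proj_surj[x xU ->]] := eqVneq v u.
  transitivity false; [|apply/esym]; apply/negP.
    case/imsetP => x /setDP[_ xU] /eqP.
    by rewrite eq_sym proj_eq_None (negbTE xU).
  by rewrite not_reach_contracted.
by rewrite mem_comp_image // mem_comp_of reach_outer // reach_proj.
Qed.

Lemma outer_compsE :
  [set D in comps (contract_set U F) | u \notin D]
    = comp_image @: [set C in comps A | ~~ (C \subset U)].
Proof.
apply/setP => D; rewrite inE; apply/andP/imsetP => [[DF uD]|[C]].
  have [v vD] := comps_neq0 DF; have vu : v != u by apply: contraNneq uD => <-.
  have [z zU Ev] := proj_surj vu; exists (comp_of A z).
    rewrite inE comp_of_comps /=; apply/subsetPn; exists z => //.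
    by rewrite mem_comp_of reach_refl.
  by rewrite comp_image_of // -Ev (comps_eq DF vD).
rewrite inE => /andP[CA /subsetPn[z zC zU]] ->.
rewrite (comps_eq CA zC) comp_image_of // comp_of_comps mem_comp_of.
by rewrite not_reach_contracted.
Qed.

Lemma comp_image_inj :
  {in [set C in comps A | ~~ (C \subset U)] &, injective comp_image}.
Proof.
move=> C C'; rewrite !inE => /andP[CA /subsetPn[z zC zU]] /andP[CA' _] CC'.
have zC' : z \in C' by rewrite -mem_comp_image // -CC' mem_comp_image.
by rewrite (comps_eq CA zC) (comps_eq CA' zC').
Qed.

(** Both sides count the edges of M that meet C: each has one end in U, which
    lies in C, and distinct edges have distinct ends in U.  Every vertex of C in
    U is met by such an edge, since C also contains a vertex outside U. *)
Lemma card_links C : C \in comps A -> ~~ (C \subset U) ->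
  #|links u (comp_image C)| = #|C :&: U|.
Proof.
move=> CA /subsetPn[z zC zU].
pose MC := [set e in boundary U | ends e :&: C != set0].
have subMC e : e \in MC -> e \in A by rewrite !inE => /andP[->].
have -> : #|links u (comp_image C)| = #|MC|.
  rewrite -(card_imset _ val_inj); apply: eq_card => e.
  apply/imsetP/idP => [[e']|].
    rewrite inE => /andP[]; rewrite inE => /andP[_]; rewrite mem_contract_ends => eM.
    case/set0Pn => v /setIP[/imsetP[x xe ->]] /imsetP[y /setDP[yC yU]].
    move=> /esym/(proj_inj yU) yx -> ; rewrite inE eM; apply/set0Pn; exists x.
    by rewrite in_setI xe -yx.
  move=> eMC; move: (eMC); rewrite inE => /andP[eM /set0Pn[t /setIP[te tC]]].
  have [e' ee] : exists e' : edge (contract U), val e' = e.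
    by apply: lift_edge; move: eM; rewrite boundaryE => /andP[].
  exists e' => //; rewrite inE [_ \in incident _ _]inE inE mem_contract_ends ee eM /=.
  have [x [y [xU yU E]]] := boundaryP eM.
  have ye : y \in ends e by rewrite E set22.
  apply/set0Pn; exists (proj y); rewrite in_setI proj_ends ?ee // mem_comp_image //.
  exact: comps_closed CA (subMC e eMC) te ye tC.
transitivity (\sum_(x in U) deg MC x)%N.
  rewrite sum_deg -sum1_card; apply: eq_bigr => e.
  by rewrite !inE => /andP[/eqP].
rewrite -sum1_card [RHS](eq_bigl (fun x => (x \in U) && (x \in C))); last first.
  by move=> x; rewrite in_setI andbC.
rewrite big_mkcondr; apply: eq_bigr => x xU; case: ifP => xC; last first.
  apply/eqP; rewrite -leqn0 leqNgt; apply/deg_gt0P => -[e eMC xe].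
  move: (eMC); rewrite inE => /andP[eM /set0Pn[t /setIP[te tC]]].
  by rewrite (comps_closed CA (subMC e eMC) te xe tC) in xC.
apply/eqP; rewrite eqn_leq; apply/andP; split.
  apply: leq_trans (deg_boundary_le1 xU); apply: subset_leq_card.
  by apply/subsetP => e; rewrite !inE => /andP[/andP[-> _] ->].
apply/contraT; rewrite -leqNgt leqn0 => d0; move: zC.
rewrite (comps_eq CA xC) mem_comp_of => /reach_isolated zx.
rewrite zx ?xU // in zU => e eA; apply/negP => xe.
have eM := inner_end_boundary xU eA xe.
have : (0 < deg MC x)%N.
  apply/deg_gt0P; exists e => //; rewrite inE eM; apply/set0Pn; exists x.
  by rewrite in_setI xe.
by rewrite (eqP d0).
Qed.

(** Every edge of M meets exactly one vertex of U, and every vertex of U at most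
    one edge of M. *)
Lemma card_unmatched :
  (#|[set x in U | deg (boundary U) x == 0%N]| + #|boundary U| = #|U|)%N.
Proof.
have -> : #|boundary U| = (\sum_(x in U) deg (boundary U) x)%N.
  by rewrite sum_deg -sum1_card; apply: eq_bigr => e; rewrite inE => /eqP.
rewrite -[RHS]sum1_card -sum1dep_card big_mkcondr -big_split /=.
apply: eq_bigr => x /deg_boundary_le1.
by case: (deg _ x) => [|[|]].
Qed.

(** The components of A inside U, #|U| - #|M| in number, contribute a factor
    #|U| each.  Any other component C contributes #|U| times the number of
    edges between u and the image of C: the latter factors make up the star
    weight, the former the power of #|U| in the right-hand side. *)
Lemma clique_weight_contract : U != set0 ->
  clique_weight U A
    = #|U|%:R ^ (#|U|%:Z - 2 - #|boundary U|%:Z)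
      * (star_weight u (contract_set U F)
         * #|U|%:R ^+ #|comps (contract_set U F)|.-1).
Proof.
move=> U0; set k : rat := #|U|%:R.
have k0 : k != 0 by rewrite pnatr_eq0 cards_eq0.
have nM := card_unmatched.
set n := #|[set x in U | _]| in nM.
rewrite /clique_weight (bigID [pred C : {set vertex G} | C \subset U]) /=.
have -> : \prod_(C in comps A | C \subset U) (#|U| * #|C :&: U|)%:R = k ^+ n.
  rewrite (eq_bigl (mem [set C in comps A | C \subset U])); last by move=> C; rewrite !inE.
  rewrite inner_compsE big_imset /=; last by move=> x y _ _ /set1_inj.
  rewrite -prodr_const; apply: eq_bigr => x; rewrite inE => /andP[xU _].
  by rewrite (setIidPl _) ?sub1set // cards1 muln1.
have -> : \prod_(C in comps A | ~~ (C \subset U)) (#|U| * #|C :&: U|)%:R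
    = star_weight u (contract_set U F)
      * k ^+ #|comps (contract_set U F)|.-1.
  have -> : star_weight u (contract_set U F)
      = \prod_(D in [set D in comps (contract_set U F) | u \notin D]) #|links u D|%:R.
    rewrite /star_weight [RHS](eq_bigl (fun D => (D \in comps (contract_set U F)) && (u \notin D))).
      by rewrite [RHS]big_mkcondr; apply: eq_bigr => D _; case: (u \in D).
    by move=> D; rewrite !inE.
  rewrite -(card_others u) -prodr_const -big_split /= outer_compsE big_imset /=;
    last exact: comp_image_inj.
  rewrite [LHS](eq_bigl (mem [set C in comps A | ~~ (C \subset U)])); last first.
    by move=> C; rewrite !inE.
  apply: eq_bigr => C; rewrite !inE => /andP[CA CU].
  by rewrite card_links // natrM mulrC.
have -> : #|U|%:Z - 2 - #|boundary U|%:Z = n%:Z - 2.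
  by rewrite -nM PoszD addrAC addrK.
by rewrite expfzDr // exprnN -exprnP mulrAC.
Qed.

End Forest.
End Stars.
End Contracting.

(** * The theorem *)

(** Two edges of M at x lie in the same star component.  Its center is not x,
    hence both edges link x to the center, and a simple star has only one. *)
Lemma stars_matched (G : mgraph) (U : {set vertex G}) :
    (forall C : {set vertex G}, C \in components (vsupport (boundary U)) (boundary U) ->
       exists2 c : vertex G, c \notin U & star_at c C (boundary U :&: induced_edges C)) ->
  forall x e f, x \in U -> e \in boundary U -> f \in boundary U ->
    x \in ends e -> x \in ends f -> e = f.
Proof.
set M := boundary U => stars x e f xU eM fM xe xf.
have suppM g t : g \in M -> t \in ends g -> t \in vsupport M.
  by move=> gM tg; apply/bigcupP; exists g.
pose C := [set y in vsupport M | connect (adj M) x y].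
have CM : C \in components (vsupport M) M.
  by apply: imset_f; apply: suppM eM xe.
have [c cU [_ centered uniq_edge]] := stars C CM.
have in_C g : g \in M -> x \in ends g -> g \in M :&: induced_edges C.
  move=> gM xg; rewrite in_setI gM inE; apply/subsetP => t tg.
  by rewrite inE (suppM g t gM tg); apply: reach_edge gM xg tg.
have cx : x != c by apply: contraNneq cU => <-.
have endsE g : g \in M -> x \in ends g -> ends g = [set c; x].
  move=> gM xg; have [cg _] := centered g (in_C g gM xg).
  have [y _ E] := endsP cg; move: xg; rewrite E !inE (negbTE cx) /=.
  by move/eqP->.
have xC : x \in C by rewrite inE connect0 (suppM e x eM xe).
have /eqP/cards1P[h hE] := uniq_edge x xC cx.
have to_h g : g \in M -> x \in ends g -> g = h.
  by move=> gM xg; apply/set1P; rewrite -hE inE in_C // endsE // eqxx.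
by rewrite (to_h e) // (to_h f).
Qed.

(** Both sums are split according to the set F of the edges of a spanning tree
    that have no end in U. *)

Section Fibers.

Variables (G : mgraph) (U : {set vertex G}) (N : {set edge G}).
Hypothesis NU : N \subset induced_edges (~: U).

Local Notation outer := (induced_edges (~: U)).
Local Notation u := (contracted_vertex U).

Lemma tau_fibers :
  tau (boundary U :|: N)
    = (\sum_(F : {set edge G} | (F \subset outer) && (N \subset F))
        #|completions (induced_edges U) (boundary U :|: F)|)%N.
Proof.
rewrite /tau -sum1_card (partition_big (fun T : {set edge G} => T :&: outer)
  (fun F => (F \subset outer) && (N \subset F))) /=; last first.
  move=> T; rewrite inE subUset => /and3P[_ _ NT].
  by rewrite subsetIr subsetI NT.
apply: eq_bigr => F /andP[FO NF]; rewrite sum1dep_card; apply: eq_card => T.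
rewrite !inE !subUset -andbA; case: (spanning_tree T) => //=.
apply/andP/andP => [[/andP[MT NT] /eqP TF]|[/andP[MT FT] /subsetP TA]].
  rewrite MT -{1}TF subsetIl; split=> //; apply/subsetP => e eT.
  rewrite -TF !in_setU in_setI eT boundaryE.
  by case: (e \in induced_edges U); case: (e \in outer).
rewrite MT (subset_trans NF FT); split=> //; rewrite eqEsubset subsetI FT FO !andbT.
apply/subsetP => e; rewrite in_setI => /andP[/TA + eO].
rewrite !in_setU boundaryE eO andbF /= => /orP[//|/inner_notin_outer].
by rewrite eO.
Qed.

Lemma sum_contract_fibers :
  \sum_(T in ST (contract_set U N)) (#|U|%:R : rat) ^+ #|incident T u|
    = \sum_(F : {set edge G} | (F \subset outer) && (N \subset F))
        #|completions (incident setT u) (contract_set U F)|%:R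
          * #|U|%:R ^+ #|comps (contract_set U F)|.-1.
Proof.
(* The set F of the edges of T avoiding U, read in G. *)
pose trace (T : {set edge (contract U)}) : {set edge G} := (val @: T) :&: outer.
have lift e : e \in outer -> exists e' : edge (contract U), val e' = e.
  by move=> eO; apply: lift_edge; apply/negP => /inner_notin_outer; rewrite eO.
have uE (e : edge (contract U)) : (u \in ends e) = (val e \notin outer).
  by rewrite mem_contract_ends boundaryE (valP e).
rewrite (partition_big trace (fun F => (F \subset outer) && (N \subset F))) /=; last first.
  move=> T; rewrite inE => /andP[_ /subsetP NT]; rewrite subsetIr /=.
  apply/subsetP => e eN; have eO := subsetP NU e eN; rewrite in_setI eO andbT.
  have [e' ee] := lift e eO; apply/imsetP; exists e' => //; apply: NT.
  by rewrite inE ee.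
apply: eq_bigr => F /andP[FO NF].
have fiberE T : (T \in ST (contract_set U N)) && (trace T == F)
    = (T \in completions (incident setT u) (contract_set U F)).
  rewrite !inE -andbA; case: (spanning_tree T) => //=.
  apply/andP/andP => [[_ /eqP TF]|[/subsetP FT /subsetP TF]]; split.
  - apply/subsetP => e; rewrite inE -TF => /setIP[/imsetP[e' e'T ee] _].
    by rewrite (val_inj ee).
  - apply/subsetP => e eT; rewrite !inE uE -TF in_setI imset_f //=.
    by case: (val e \in outer).
  - apply/subsetP => e; rewrite inE => eN; apply: FT.
    by rewrite inE (subsetP NF).
  - apply/eqP/setP => e; rewrite in_setI; apply/andP/idP => [[/imsetP[e' e'T ->] eO]|eF].
      by have := TF e' e'T; rewrite !inE uE eO orbF.
    have eO := subsetP FO e eF; have [e' ee] := lift e eO; split=> //.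
    by apply/imsetP; exists e' => //; apply: FT; rewrite inE ee.
rewrite [RHS]mulr_natl -[RHS]sumr_const; apply: eq_big => [T|T TF]; first exact: fiberE.
rewrite fiberE in TF; congr (_ ^+ _); rewrite -(card_completion TF).
move: TF; rewrite -fiberE => /andP[_ /eqP TF]; apply: eq_card => e.
rewrite !inE andbC uE; case: (boolP (e \in T)) => eT; rewrite ?andbF //= -TF.
by rewrite in_setI imset_f // andbT.
Qed.

End Fibers.

Theorem theorem3p1 (G : mgraph) (U : {set vertex G}) (M N : {set edge G})
    (G_connected : connected G)
    (U_nonempty : U != set0)
    (U_clique : clique U)
    (M_def : M = boundary U)
    (N_sub : N \subset induced_edges (~: U))
    (M_stars : forall C : {set vertex G}, C \in components (vsupport M) M ->
       exists2 c : vertex G, c \notin U & star_at c C (M :&: induced_edges C)) :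
  (tau (M :|: N))%:R
  = (#|U|%:R : rat) ^ (#|U|%:Z - 2 - #|M|%:Z)
    * \sum_(T in ST (contract_set U N))
        #|U|%:R ^+ #|incident T (contracted_vertex U)|.
Proof.
rewrite {M}M_def in M_stars *; have matched := stars_matched M_stars.
have [x xU] := set0Pn _ U_nonempty.
rewrite (tau_fibers N_sub) (sum_contract_fibers N_sub) natr_sum mulr_sumr.
apply: eq_bigr => F /andP[FO _].
have [acyF|cycF] := boolP (acyclic F).
  rewrite (card_clique_completions U_clique xU (acyclic_boundary matched FO acyF)).
  rewrite clique_weight_contract // card_star_completions //.
  by rewrite acyclic_contract.
have no_completion (H : mgraph) (S A : {set edge H}) :
    ~~ acyclic A -> #|completions S A| = 0%N.
  move=> cycA; apply/eqP; rewrite cards_eq0; apply/eqP/setP => T; rewrite [RHS]inE.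
  by apply: contraNF cycA => /completions_acyclic.
rewrite !no_completion ?mul0r ?mulr0 //; first by rewrite acyclic_contract.
by apply: contraNN cycF; apply: acyclic_sub; apply: subsetUr.
Qed.
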